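(* Suppose $G$ is a semidirect product $A \rtimes B$ of two finite cyclic groups (with $A$ normal), where $B$ has prime order $p$ and where $p$ does not divide the order of $A$. Then $G$ is freely representable if and only if $G$ is cyclic.
   Context: A free linear representation of a group $G$ over a field $F$ is a linear action of $G$ on an $F$-vector space $V \neq 0$ such that $gv \neq v$ for all $g \neq 1$ in $G$ and all nonzero $v \in V$. A finite group is freely representable if it has a free linear representation over $\mathbb{C}$. *)

(* Defs.v *)
From HB Require Import structures.
From mathcomp Require Import all_boot all_order all_algebra all_fingroup.
From mathcomp Require Import all_solvable.
From mathcomp Require Import reals.
From mathcomp Require Import complex.
Set Implicit Arguments.
Unset Strict Implicit.
Unset Printing Implicit Defensive.
Import Order.TTheory GRing.Theory Num.Theory.

Local Open Scope ring_scope.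

(* [rho] is a left action of G on V by F-linear maps; its values outside G are
   irrelevant.  V may be infinite-dimensional, so the matrix-valued
   [mx_representation] is not general enough. *)
Definition linear_action (F : fieldType) (gT : finGroupType) (G : {group gT})
    (V : lmodType F) (rho : gT -> {linear V -> V}) : Prop :=
  (forall v : V, rho 1%g v = v) /\
  (forall g h : gT, g \in G -> h \in G ->
     forall v : V, rho (g * h)%g v = rho g (rho h v)).

Definition free_linear_representation (F : fieldType) (gT : finGroupType)
    (G : {group gT}) (V : lmodType F) (rho : gT -> {linear V -> V}) : Prop :=
  [/\ linear_action G rho,
      exists v : V, v != 0
    & forall g : gT, g \in G -> g != 1%g ->
        forall v : V, v != 0 -> rho g v != v].

(* The field of complex numbers is R[i], where R is any model of the reals. *)
Definition freely_representable (R : realType) (gT : finGroupType)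
    (G : {group gT}) : Prop :=
  exists (V : lmodType R[i]) (rho : gT -> {linear V -> V}),
    free_linear_representation G rho.

(* Main.v *)
(** If [B] does not centralize [A], then, by coprimality, [[~: A, B] <*> B] is a
    Frobenius group, hence is partitioned by its kernel [K] and the sets
    [B^# :^ x], for [x] in [K].  In a free representation the operators of any
    nontrivial subgroup sum to [0] (their sum has image in the fixed points), so
    those of each [B^# :^ x] sum to [-1]; summing over the whole Frobenius group
    yields [0 = 0 - N] with [N > 0], which is absurd in characteristic 0. *)

Require Import Defs.
From HB Require Import structures.
From mathcomp Require Import all_boot all_order all_algebra all_fingroup.
From mathcomp Require Import all_solvable.
From mathcomp Require Import separable cyclotomic.
From mathcomp Require Import reals.
From mathcomp Require Import complex.
Set Implicit Arguments.
Unset Strict Implicit.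
Unset Printing Implicit Defensive.
Import Order.TTheory GRing.Theory Num.Theory.

(** ['X^n - 1] splits, and is separable in characteristic 0, so there are [n] distinct [n]-th roots
    of unity; such a full set must contain a primitive one. *)
Lemma prim_root_exists (F : numClosedFieldType) (n : nat) :
  0 < n -> exists z : F, (n.-primitive_root z)%R.
Proof.
move=> n_gt0.
have [r] := closed_field_poly_normal ('X^n - 1 : {poly F})%R.
rewrite lead_coefXnsubC // scale1r => Dr.
have /hasP[z _ prim_z] : has n.-primitive_root%R r; last by exists z.
apply: has_prim_root => //.
- by apply/allP=> z; rewrite -root_prod_XsubC -Dr.
- by rewrite -separable_prod_XsubC -Dr separable_Xn_sub_1 ?pnatr_eq0 -?lt0n.
- by rewrite -ltnS -(size_prod_XsubC r id) -Dr size_XnsubC.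
Qed.

Lemma cyclic_faithful_char (F : fieldType) (gT : finGroupType)
    (G : {group gT}) (z : F) :
  cyclic G -> (#|G|.-primitive_root z)%R ->
  exists chi : gT -> F,
    [/\ chi 1%g = 1%R,
        forall g h, g \in G -> h \in G -> chi (g * h)%g = (chi g * chi h)%R
      & forall g, g \in G -> chi g = 1%R -> g = 1%g].
Proof.
case/cyclicP=> x defG prim_z; rewrite defG in prim_z *.
(* [k] is a discrete logarithm in base [x]; outside [<[x]>] any value will do. *)
have [k xk] : exists k : gT -> nat, forall g, g \in <[x]>%g -> (x ^+ k g)%g = g.
  apply: (fin_all_exists (P := fun g i => g \in <[x]>%g -> (x ^+ i)%g = g)) => g.
  by case: (boolP (g \in <[x]>%g)) => [/cycleP[i ->] | _]; [exists i | exists 0].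
(* [z] and [x] have the same order, so [x ^+ i] can be sent to [z ^+ i] consistently and
   injectively. *)
have zE i j : (z ^+ i == z ^+ j)%R = (x ^+ i == x ^+ j)%g.
  by rewrite (eq_prim_root_expr prim_z) eq_expg_mod_order.
exists (fun g => z ^+ k g)%R; split.
- by apply/eqP; rewrite -(expr0 z) zE xk ?group1.
- move=> g h Gg Gh; apply/eqP.
  by rewrite -exprD zE expgD !xk ?groupM.
- move=> g Gg /eqP; rewrite -(expr0 z) zE xk // => /eqP.
  by rewrite expg0.
Qed.

(** The group acts on a line by scaling through a faithful character: a nonzero fixed vector forces
    [chi g = 1], hence [g = 1]. *)
Lemma cyclic_freely_representable (R : realType) (gT : finGroupType)
    (G : {group gT}) :
  cyclic G -> freely_representable R G.
Proof.
move=> cycG.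
have [z prim_z] := @prim_root_exists R[i] #|G| (cardG_gt0 G).
have [chi [chi1 chiM chi_inj]] := cyclic_faithful_char cycG prim_z.
exists (R[i]^o)%R, (fun g => ( *:%R (chi g)) : {linear R[i]^o -> R[i]^o}%R).
split=> [|| g Gg ntg v ntv /=].
- split=> [v /= | g h Gg Gh v /=]; first by rewrite chi1 scale1r.
  by rewrite chiM // scalerA.
- by exists 1%R; apply: oner_neq0.
- apply: contra ntg => /eqP Dv; apply/eqP/chi_inj => //.
  by apply: (mulIf ntv); rewrite mul1r.
Qed.

Section FreeSums.

Variables (F : numFieldType) (gT : finGroupType) (G : {group gT}).
Variables (V : lmodType F) (rho : gT -> {linear V -> V}).
Hypothesis freeV : free_linear_representation G rho.

Lemma free_sum_subgroup (H : {group gT}) (v : V) :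
  H \subset G -> H :!=: 1%g -> (\sum_(g in H) rho g v = 0)%R.
Proof.
case: freeV => -[_ rhoM] _ freeG sHG /trivgPn[h Hh nth].
apply/eqP; apply: contraT => nzs.
have /negP[] := freeG h (subsetP sHG h Hh) nth _ nzs.
rewrite linear_sum; apply/eqP.
(* Left translation by [h] permutes [H], so [rho h] fixes the sum. *)
rewrite [RHS](reindex_inj (mulgI h)) /=.
rewrite [RHS](eq_bigl (mem H)); last by move=> g; rewrite /= groupMl.
by apply: eq_bigr => g Hg; rewrite rhoM ?(subsetP sHG).
Qed.

Lemma free_sum_subgroupD1 (H : {group gT}) (v : V) :
  H \subset G -> H :!=: 1%g -> (\sum_(g in H^#%g) rho g v = - v)%R.
Proof.
move=> sHG ntH; have := free_sum_subgroup v sHG ntH.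
rewrite (big_setD1 1%g) //=; case: freeV => -[-> _] _ _.
by move/eqP; rewrite addrC addr_eq0 => /eqP.
Qed.

Lemma free_not_Frobenius (L K H : {group gT}) :
  L \subset G -> [Frobenius L = K ><| H]%g -> False.
Proof.
move=> sLG frobL.
have [defL ntK ntH pKL pHL] := Frobenius_context frobL.
have ntL : L :!=: 1%g.
  by apply: contraNneq ntK => L1; rewrite -subG1 -L1 proper_sub.
have [sKL sHL] := (proper_sub pKL, proper_sub pHL).
case: (freeV) => _ [v nzv] _.
have := free_sum_subgroup v sLG ntL.
rewrite (set_partition_big _ (Frobenius_partition frobL)) /=.
(* [K] contains 1 and the conjugates of [H^#] do not, so [K] is a separate block of the
   partition. *)
have K'HK : gval K \notin (H^# :^: K)%g.
  apply/imsetP=> -[x _ /setP/(_ 1%g)].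
  by rewrite group1 conjD1g !inE eqxx.
rewrite big_setU1 //= free_sum_subgroup ?(subset_trans sKL) // add0r.
rewrite (eq_bigr (fun=> - v)%R) => [|_ /imsetP[x Kx ->]]; last first.
  rewrite conjD1g; apply: (free_sum_subgroupD1 (H := (H :^ x)%G)) => /=.
    by rewrite conj_subG ?(subsetP (subset_trans sKL sLG)) ?(subset_trans sHL).
  by rewrite -subG1 sub_conjg conjs1g subG1.
rewrite sumr_const -scaler_nat => /eqP.
rewrite scaler_eq0 oppr_eq0 (negPf nzv) orbF pnatr_eq0 cards_eq0 => /eqP/setP.
(* The number of conjugates would be 0, yet [H^#] is one of them. *)
by move/(_ (H^# :^ 1)%g); rewrite inE imset_f.
Qed.

End FreeSums.

(** The kernel is [[~: A, B]] rather than [A], since [B] may fix nontrivial elements of [A]; coprime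
    action on an abelian group leaves none in the commutator. *)
Lemma coprime_prime_Frobenius (gT : finGroupType) (A B : {group gT}) :
  B \subset 'N(A)%g -> abelian A -> prime #|B| -> coprime #|A| #|B| ->
  ~~ (A \subset 'C(B))%g -> [Frobenius [~: A, B] <*> B = [~: A, B] ><| B]%g.
Proof.
move=> nAB abA pr_B coAB; rewrite (sameP commG1P eqP) => ntK.
have sKA : [~: A, B]%g \subset A by rewrite commg_subl.
have tiKB : ([~: A, B] :&: B = 1)%g.
  by apply: coprime_TIg; apply: coprime_dvdl (cardSg sKA) coAB.
apply/Frobenius_semiregularP => //; first by rewrite sdprodEY ?commg_normr.
  by rewrite -cardG_gt1 prime_gt1.
move=> b /setD1P[ntb Bb]; rewrite -cent_cycle.
(* As [#|B|] is prime, each nontrivial [b] generates [B]. *)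
suffices -> : <[b]>%g = B by apply: coprime_abel_cent_TI.
apply/eqP; rewrite eqEcard cycle_subG Bb /=.
have /(prime_nt_dvdP pr_B) : #[b]%g != 1 by rewrite order_eq1.
by move=> /(_ (order_dvdG Bb)) oBb; rewrite -oBb.
Qed.

Theorem theorem74 (R : realType) (gT : finGroupType) (G A B : {group gT})
    (p : nat) (defG : (A ><| B)%g = G :> {set gT})
    (cycA : cyclic A) (cycB : cyclic B)
    (p_prime : prime p) (oB : #|B| = p) (pA : ~~ (p %| #|A|)) :
  freely_representable R G <-> cyclic G.
Proof.
split=> [[V [rho freeV]] | ]; last exact: cyclic_freely_representable.
have [_ /mulG_sub[sAG sBG] nAB tiAB] := sdprodP defG.
have coAB : coprime #|A| #|B| by rewrite oB coprime_sym prime_coprime.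
case: (boolP (A \subset 'C(B))%g) => [cBA | ncAB].
  (* Here [G] is a direct product of cyclic groups of coprime orders. *)
  rewrite (@cyclic_dprod _ A B G) //.
  by rewrite dprodEsd // centsC.
have frob : [Frobenius [~: A, B] <*> B = [~: A, B] ><| B]%g.
  by apply: coprime_prime_Frobenius; rewrite ?cyclic_abelian // oB.
case: (free_not_Frobenius freeV _ frob).
by rewrite join_subG sBG (subset_trans _ sAG) ?commg_subl.
Qed.
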